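(* Let $\mathcal{M}$ be a Minsky machine satisfying the standing assumptions below and let $m\ge1$. (1) If $\mathcal{M}^n(1,0,0)=(k,\alpha,\beta)$ and $\mathcal{M}$ has $n$-step capacity $m-1$, then $\mathrm{Config}(k,\alpha,\beta)\subseteq S_m$. (2) If $\mathrm{Config}(k,\alpha,\beta)\subseteq S_m$ (where $\alpha+\beta<m$) and $\mathcal{M}$ does not halt with capacity $m-1$, then for some $n$ we have $\mathcal{M}^n(1,0,0)=(k,\alpha,\beta)$ and $\mathcal{M}$ has $n$-step capacity $m-1$.
   Context: Minsky machines. A Minsky machine $\mathcal{M}$ has states $\{0,1,\dots,N\}$ ($0$ is the halting state, $1$ the initial state), two registers $A,B$ holding values in $\mathbb{N}$, and a finite set of instructions of the forms $(i,R,j)$ and $(i,R,k,j)$ with $R\in\{A,B\}$. It acts on configurations $(s,\alpha,\beta)\in\{0,\dots,N\}\times\mathbb{N}\times\mathbb{N}$: $\mathcal{M}(i,\alpha,\beta)$ is $(j,\alpha+1,\beta)$ if $(i,A,j)\in\mathcal{M}$; $(j,\alpha,\beta+1)$ if $(i,B,j)\in\mathcal{M}$; $(j,\alpha-1,\beta)$ if $(i,A,k,j)\in\mathcal{M}$ and $\alpha\neq0$; $(j,\alpha,\beta-1)$ if $(i,B,k,j)\in\mathcal{M}$ and $\beta\ne 0$; $(k,\alpha,\beta)$ if $(i,A,k,j)\in\mathcal{M}$ and $\alpha=0$, or $(i,B,k,j)\in\mathcal{M}$ and $\beta=0$; and $(0,\alpha,\beta)$ if $i=0$. $\mathcal{M}^n$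 denotes the $n$-fold composite, and $\mathcal{M}$ halts if $\mathcal{M}^n(1,0,0)$ has state $0$ for some $n$. Standing assumptions on $\mathcal{M}$: it returns both registers to $0$ before halting; it has exactly one instruction $(i,\dots)$ for each non-halting state $i$; the instruction for state $1$ has the form $(1,R,s)$; and in the state graph (vertices the states, an edge $i\to j$ iff $\mathcal{M}(i,\alpha,\beta)=(j,\alpha',\beta')$ for some $\alpha,\beta,\alpha',\beta'$) every state is reachable from $1$ and $0$ is reachable from every state. $\mathcal{M}$ has $k$-step capacity $C$ if $C\ge\alpha+\beta$ whenever $\mathcal{M}^n(1,0,0)=(i,\alpha,\beta)$ for some $n\le k$; it has capacity $C$ if this holds for all $n$; it halts with capacity $C$ if it has capacity $C$ and halts. The algebra. $A(\mathcal{M})=\{\langle i,c\rangle: 0\le i\le N,\ c\in\{\bullet,\times,0,A,B\}\}$. Put $X=\{\langle i,\times\rangle\}$, $D=\{\langle i,\bullet\rangle\}$, $C=A(\mathcal{M})\setminus(X\cup D)$; $\mathrm{X}(\langle i,c\rangle)=\langle i,\times\rangle$, $\mathrm{State}(\langle i,c\rangle)=i$, $\mathrm{Content}(\langle i,c\rangle)=c$. Write ''$(i,R,\dots,j)\in\mathcal{M}$'' to mean $(i,R,j)\in\mathcal{M}$ or $(i,R,k,j)\in\mathcal{M}$ for some $k$. The operations (cases read in order, first applicable case applies): $\langle i,c\rangle\wedge\langle j,d\rangle$ is $\langle i,c\rangle$ if the two are equal, else $\langle\min(i,j),\times\rangle$. $M(x,y)$: $\langle j,R\rangle$ if $x=\langle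 i,\bullet\rangle, y=\langle i,0\rangle,(i,R,j)\in\mathcal{M}$; $\langle j,0\rangle$ if $x=\langle i,\bullet\rangle,y=\langle i,R\rangle,(i,R,k,j)\in\mathcal{M}$; $\langle j,\bullet\rangle$ if $x=\langle i,0\rangle,y=\langle i,\bullet\rangle,(i,R,j)\in\mathcal{M}$; $\langle j,\bullet\rangle$ if $x=\langle i,R\rangle,y=\langle i,\bullet\rangle,(i,R,k,j)\in\mathcal{M}$; $\langle j,c\rangle$ if $x=y=\langle i,c\rangle$, $c\ne\bullet$, $(i,R,\dots,j)\in\mathcal{M}$; $\langle j,\times\rangle$ if $\mathrm{State}(x)=\mathrm{State}(y)=i$ and $(i,R,\dots,j)\in\mathcal{M}$; otherwise $\mathrm{X}(y)$. $M'(x)$: $\langle k,c\rangle$ if $x=\langle i,c\rangle$, $(i,R,k,j)\in\mathcal{M}$, $c\neq R$; $\langle k,\times\rangle$ if $\mathrm{State}(x)=i$ and $(i,R,k,j)\in\mathcal{M}$; otherwise $\mathrm{X}(x)$. $I(x,y)$: $\langle1,\bullet\rangle$ if $x\in D$; $\langle 1,0\rangle$ if $y\in C$; otherwise $\langle1,\times\rangle$. $H(x)$: $\langle0,0\rangle$ if $x\in\{\langle0,0\rangle,\langle0,\bullet\rangle\}$, otherwise $\langle0,\times\rangle$. $N_0(x,y,z)$: $y$ if $x=\langle0,\bullet\rangle$ and $\mathrm{State}(y)=\mathrm{State}(z)$; $z$ if $x=\langle0,0\rangle$, $z\notin D$, $\mathrm{State}(y)=\mathrm{State}(z)$; otherwise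 $\mathrm{X}(y\wedge z)$. $S(x,y,z)$: $\langle1,0\rangle$ if $x=\langle1,0\rangle$, $\mathrm{State}(y)=\mathrm{State}(z)=1$ and $(\mathrm{Content}(y),\mathrm{Content}(z))\in\{(\bullet,0),(0,\bullet),(0,0)\}$; otherwise $\langle1,\times\rangle$. $N_\bullet(u,x,y,z)$, where the first four cases require $\mathrm{State}(x)=\mathrm{State}(y)=\mathrm{State}(z)$: $x$ if $x=y\notin X$; $x$ if $u\in D$, $y\in X$; $y$ if $u\in D$, $x\in X$; $z$ if $u\in D$, $z\in\{x,y\}$; otherwise $\mathrm{X}(x\wedge y\wedge z)$. $P(u,v,x,y)$: $x$ if $\mathrm{State}(u)=\mathrm{State}(v)$, else $y$. $\mathbb{A}(\mathcal{M})=\langle A(\mathcal{M});\wedge,M,M',I,H,N_0,S,N_\bullet,P\rangle$; operations act coordinatewise on powers $A(\mathcal{M})^m$. Further notation. For $i\in[m]$ let $\sigma_i\in A(\mathcal{M})^m$ have $\sigma_i(i)=\langle1,\bullet\rangle$ and $\sigma_i(j)=\langle1,0\rangle$ for $j\ne i$; $S_m$ is the subuniverse of $A(\mathcal{M})^m$ generated by $\{\sigma_1,\dots,\sigma_m\}$. For a state $k$ and $\alpha,\beta\in\mathbb{N}$ with $\alpha+\beta<m$, $\mathrm{Config}(k,\alpha,\beta)\subseteq A(\mathcal{M})^m$ is the set of all tuples obtained by permuting the coordinates of the tuple consisting of one entry $\langle k,\bullet\rangle$, $\alpha$ entries $\langle k,A\rangle$, $\beta$ entries $\langle k,B\rangle$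 and $m-\alpha-\beta-1$ entries $\langle k,0\rangle$. *)

(* Defs.v *)
From HB Require Import structures.
From Stdlib Require Import Relation_Operators.
From mathcomp Require Import all_boot all_fingroup.

Set Implicit Arguments.
Unset Strict Implicit.
Unset Printing Implicit Defensive.

Inductive reg := RegA | RegB.

Definition bool_of_reg r := if r is RegA then true else false.
Definition reg_of_bool (b : bool) := if b then RegA else RegB.
Lemma bool_of_regK : cancel bool_of_reg reg_of_bool. Proof. by case. Qed.
HB.instance Definition _ := Finite.copy reg (can_type bool_of_regK).

(* The state set {0, ..., N} of the text is ['I_n.+2] with [N = n.+1], so that
   the initial state 1 always exists and is distinct from the halting state. *)
Notation state n := 'I_n.+2.
Definition halting {n} : state n := @Ordinal n.+2 0 isT.
Definition initial {n} : state n := @Ordinal n.+2 1 isT.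

(* [inl (i, R, j)] is the instruction (i,R,j) (increment R, go to j);
   [inr (i, R, k, j)] is (i,R,k,j) (if R is zero go to k, otherwise decrement R
   and go to j). *)
Notation instr n :=
  (state n * reg * state n + state n * reg * state n * state n)%type.
Notation machine n := {set instr n}.

Section Machine.
Variables (n : nat) (mach : machine n).

Definition source (q : instr n) : state n :=
  match q with inl (i, _, _) => i | inr (i, _, _, _) => i end.

(* Under [standing] below, this is the unique instruction of [mach] with source
   [i], or [None] if [i] is the halting state. *)
Definition instr_at (i : state n) : option (instr n) :=
  [pick q in mach | source q == i].

Definition conf : Type := state n * nat * nat.

Definition step (x : conf) : conf :=
  let: (i, a, b) := x in
  if i == halting then (halting, a, b) else
  match instr_at i with
  | Some (inl (_, RegA, j)) => (j, a.+1, b)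
  | Some (inl (_, RegB, j)) => (j, a, b.+1)
  | Some (inr (_, RegA, k, j)) => if a != 0 then (j, a.-1, b) else (k, a, b)
  | Some (inr (_, RegB, k, j)) => if b != 0 then (j, a, b.-1) else (k, a, b)
  | None => x
  end.

Definition run (t : nat) : conf := iter t step (initial, 0, 0).

Definition halts : Prop := exists t a b, run t = (halting, a, b).

Definition step_capacity (t c : nat) : Prop :=
  forall s i a b, s <= t -> run s = (i, a, b) -> a + b <= c.

Definition capacity (c : nat) : Prop :=
  forall s i a b, run s = (i, a, b) -> a + b <= c.

Definition halts_with_capacity (c : nat) : Prop := capacity c /\ halts.

Definition edge (i j : state n) : Prop :=
  exists a b a' b', step (i, a, b) = (j, a', b').

Definition reachable : state n -> state n -> Prop := clos_refl_trans _ edge.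

(* [no_halting_instr] is what makes the action on configurations well defined:
   the halting state only has the rule (0,a,b) |-> (0,a,b). *)
Record standing : Prop := Standing {
  zero_before_halting :
    forall t a b, run t = (halting, a, b) -> a = 0 /\ b = 0;
  one_instr :
    forall i, i <> halting -> exists! q, q \in mach /\ source q = i;
  no_halting_instr : forall q, q \in mach -> source q <> halting;
  initial_increments : exists R s, inl (initial, R, s) \in mach;
  reachable_from_initial : forall i, reachable initial i;
  halting_reachable : forall i, reachable i halting
}.

End Machine.

(* The five symbols bullet, times, 0, A, B. *)
Inductive content := Dot | Cross | Zero | Reg of reg.

Definition content_code c : option (option (option reg)) :=
  match c with
  | Dot => None | Cross => Some None | Zero => Some (Some None)
  | Reg r => Some (Some (Some r))
  end.
Definition content_decode (o : option (option (option reg))) :=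
  match o with
  | None => Dot | Some None => Cross | Some (Some None) => Zero
  | Some (Some (Some r)) => Reg r
  end.
Lemma content_codeK : cancel content_code content_decode.
Proof. by case. Qed.
HB.instance Definition _ := Finite.copy content (can_type content_codeK).

Notation elt n := (state n * content)%type.

Section Operations.
Variables (n : nat) (mach : machine n).
Implicit Types u v x y z : elt n.

Definition St x : state n := x.1.
Definition Content x : content := x.2.
Definition inX x : bool := Content x == Cross.
Definition inD x : bool := Content x == Dot.
Definition inC x : bool := ~~ inX x && ~~ inD x.
Definition toX x : elt n := (St x, Cross).

Definition op_meet x y : elt n :=
  if x == y then x else (if St x <= St y then St x else St y, Cross).

Definition op_M x y : elt n :=
  if St x == St y then
    match instr_at mach (St x) with
    | Some (inl (_, R, j)) =>
        if (Content x == Dot) && (Content y == Zero) then (j, Reg R)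
        else if (Content x == Zero) && (Content y == Dot) then (j, Dot)
        else if (x == y) && (Content x != Dot) then (j, Content x)
        else (j, Cross)
    | Some (inr (_, R, _, j)) =>
        if (Content x == Dot) && (Content y == Reg R) then (j, Zero)
        else if (Content x == Reg R) && (Content y == Dot) then (j, Dot)
        else if (x == y) && (Content x != Dot) then (j, Content x)
        else (j, Cross)
    | None => toX y
    end
  else toX y.

Definition op_M' x : elt n :=
  match instr_at mach (St x) with
  | Some (inr (_, R, k, _)) =>
      if Content x != Reg R then (k, Content x) else (k, Cross)
  | _ => toX x
  end.

Definition op_I x y : elt n :=
  if inD x then (initial, Dot)
  else if inC y then (initial, Zero)
  else (initial, Cross).

Definition op_H x : elt n :=
  if (x == (halting, Zero)) || (x == (halting, Dot)) then (halting, Zero)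
  else (halting, Cross).

Definition op_N0 x y z : elt n :=
  if (x == (halting, Dot)) && (St y == St z) then y
  else if [&& x == (halting, Zero), ~~ inD z & St y == St z] then z
  else toX (op_meet y z).

Definition op_S x y z : elt n :=
  if [&& x == (initial, Zero), St y == initial, St z == initial
       & (Content y, Content z) \in [:: (Dot, Zero); (Zero, Dot); (Zero, Zero)]]
  then (initial, Zero) else (initial, Cross).

Definition op_Ndot u x y z : elt n :=
  let same := (St x == St y) && (St y == St z) in
  if [&& same, x == y & ~~ inX x] then x
  else if [&& same, inD u & inX y] then x
  else if [&& same, inD u & inX x] then y
  else if [&& same, inD u & (z == x) || (z == y)] then z
  else toX (op_meet (op_meet x y) z).

Definition op_P u v x y : elt n := if St u == St v then x else y.

End Operations.

Notation pow n m := {ffun 'I_m -> elt n}.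

Section Powers.
Variables (n : nat) (mach : machine n) (m : nat).

Inductive generated (G : pow n m -> Prop) : pow n m -> Prop :=
| gen_base f : G f -> generated G f
| gen_meet f g : generated G f -> generated G g ->
    generated G [ffun p => op_meet (f p) (g p)]
| gen_M f g : generated G f -> generated G g ->
    generated G [ffun p => op_M mach (f p) (g p)]
| gen_M' f : generated G f -> generated G [ffun p => op_M' mach (f p)]
| gen_I f g : generated G f -> generated G g ->
    generated G [ffun p => op_I (f p) (g p)]
| gen_H f : generated G f -> generated G [ffun p => op_H (f p)]
| gen_N0 f g h : generated G f -> generated G g -> generated G h ->
    generated G [ffun p => op_N0 (f p) (g p) (h p)]
| gen_S f g h : generated G f -> generated G g -> generated G h ->
    generated G [ffun p => op_S (f p) (g p) (h p)]
| gen_Ndot e f g h : generated G e -> generated G f -> generated G g ->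
    generated G h -> generated G [ffun p => op_Ndot (e p) (f p) (g p) (h p)]
| gen_P e f g h : generated G e -> generated G f -> generated G g ->
    generated G h -> generated G [ffun p => op_P (e p) (f p) (g p) (h p)].

Definition sigma (i : 'I_m) : pow n m :=
  [ffun p => (initial, if p == i then Dot else Zero)].

Definition S_ : pow n m -> Prop := generated (fun f => exists i, f = sigma i).

Definition config_word (k : state n) (a b : nat) : pow n m :=
  [ffun p : 'I_m => (k, if p == 0 :> nat then Dot
                        else if p <= a then Reg RegA
                        else if p <= a + b then Reg RegB
                        else Zero)].

(* Only meaningful when a + b < m. *)
Definition Config (k : state n) (a b : nat) (f : pow n m) : Prop :=
  exists s : 'S_m, f = [ffun p => config_word k a b (s p)].

End Powers.

(* Main.v *)
Require Import Defs.
From mathcomp Require Import all_boot.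
From mathcomp Require Import all_fingroup zify.

(* Each machine step is simulated by [M] (acting on two configurations that
   differ in the positions of the dot and of one register symbol) or by [M'], so
   reached configurations are generated.
   Conversely, every generated tuple has a constant state and at most one dot,
   and if it has no cross it is a configuration reached within capacity. The last
   invariant survives the operations because a cross-free value of [M] forces its
   arguments to be two such configurations and makes a machine step, [M'] makes a
   zero-test step, [I] returns some [sigma p], the meet, [Ndot] and [P] return
   one of their arguments, and [H], [N0] and [S] have no cross-free value: [S]
   would need a cross-free tuple without a dot, [H] and [N0] a cross-free tuple in
   the halting state, i.e. a halting run within capacity. The capacity bound itself
   is automatic, since a configuration in [m] coordinates holds at most [m - 1]
   register symbols. *)

Set Implicit Arguments.
Unset Strict Implicit.
Unset Printing Implicit Defensive.

(** * Instructions as rewritings of one symbol *)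

Section Instructions.
Variables (n : nat) (mach : machine n).

Definition target (q : instr n) : state n :=
  match q with inl (_, _, j) => j | inr (_, _, _, j) => j end.

(* An instruction is read as the rewriting of one register symbol: incrementing
   [R] turns a [Zero] into a [Reg R], decrementing [R] does the converse. *)
Definition erased (q : instr n) : content :=
  match q with inl _ => Zero | inr (_, R, _, _) => Reg R end.
Definition written (q : instr n) : content :=
  match q with inl (_, R, _) => Reg R | inr _ => Zero end.

Lemma erased_Dot q : (erased q == Dot) = false.
Proof. by case: q => [[[? ?] ?]|[[[? ?] ?] ?]]. Qed.

Lemma written_Dot q : (written q == Dot) = false.
Proof. by case: q => [[[? ?] ?]|[[[? ?] ?] ?]]. Qed.

Lemma erased_Cross q : (erased q == Cross) = false.
Proof. by case: q => [[[? ?] ?]|[[[? ?] ?] ?]]. Qed.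

(** Both kinds of instruction obey one formula once phrased by [erased] and [written]. *)
Lemma op_M_instr q k c d : instr_at mach k = Some q ->
  op_M mach (k, c) (k, d) =
    (target q, if (c == Dot) && (d == erased q) then written q
               else if (c == erased q) && (d == Dot) then Dot
               else if (c == d) && (c != Dot) then c else Cross).
Proof.
rewrite /op_M /St /Content /= eqxx xpair_eqE eqxx /= => ->.
by case: q => [[[? R] j]|[[[? R] ?] j]] /=; do ![case: ifP => _].
Qed.

(* The junk value at [Zero] makes a test for nonzero succeed for increments. *)
Definition register_content (a b : nat) (c : content) : nat :=
  match c with
  | Dot => 1 | Cross => 0 | Zero => 1 | Reg RegA => a | Reg RegB => b
  end.

(** The additive balance avoids truncated subtraction and has the shape of [tally_exchange]; [Zero]
    is left out because its [register_content] is a junk value. *)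
Lemma step_fires q k a b : k != halting -> instr_at mach k = Some q ->
  0 < register_content a b (erased q) ->
  exists a' b', step mach (k, a, b) = (target q, a', b') /\
    forall c, c != Zero ->
      register_content a' b' c + (erased q == c) =
      register_content a b c + (written q == c).
Proof.
move=> /negbTE k0; rewrite /step k0 => ->.
case: q => [[[? []] j]|[[[? []] ?] j]] /= h.
- by exists a.+1, b; split=> // -[||| []] //=; rewrite ?addn0 ?addn1.
- by exists a, b.+1; split=> // -[||| []] //=; rewrite ?addn0 ?addn1.
- by exists a.-1, b; rewrite -lt0n h; split=> // -[||| []] //=; lia.
- by exists a, b.-1; rewrite -lt0n h; split=> // -[||| []] //=; lia.
Qed.

Lemma step_zero k i R k' j a b : k != halting ->
  instr_at mach k = Some (inr (i, R, k', j)) ->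
  register_content a b (Reg R) = 0 -> step mach (k, a, b) = (k', a, b).
Proof.
by move=> /negbTE k0; rewrite /step k0 => -> /=; case: R => ->.
Qed.

End Instructions.

(** * Counting symbols; configurations described by their counts *)

Section Tally.
Variables (n m : nat).
Implicit Types (f g : pow n m) (c : content) (p q : 'I_m).

Definition tally f c : nat := \sum_p ((f p).2 == c).

Lemma tally_total f : \sum_c tally f c = m.
Proof.
rewrite exchange_big /= -[RHS]card_ord -sum1_card; apply: eq_bigr => p _.
by rewrite (bigD1 (f p).2) //= eqxx big1 // => c /negbTE; rewrite eq_sym => ->.
Qed.

Lemma tally_gt0P f c : reflect (exists p, (f p).2 = c) (0 < tally f c).
Proof.
apply: (iffP idP) => [|[p fp]]; last by rewrite /tally (bigD1 p) //= fp eqxx.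
rewrite lt0n sum_nat_eq0 negb_forall => /existsP[p].
by rewrite implyTb eqb0 negbK => /eqP; exists p.
Qed.

Lemma tally_eq0 f c : (forall p, (f p).2 != c) -> tally f c = 0.
Proof. by move=> h; apply: big1 => p _; rewrite (negbTE (h p)). Qed.

Lemma tally_split f c p q : p != q ->
  tally f c = ((f p).2 == c) + ((f q).2 == c)
              + \sum_(r | (r != p) && (r != q)) ((f r).2 == c).
Proof.
by move=> pq; rewrite /tally (bigD1 p) //= (bigD1 q) ?addnA //= eq_sym.
Qed.

Lemma tally_exchange f g p q c : p != q ->
  (forall r, r != p -> r != q -> (f r).2 = (g r).2) ->
  tally f c + (((g p).2 == c) + ((g q).2 == c)) =
  tally g c + (((f p).2 == c) + ((f q).2 == c)).
Proof.
move=> pq fg; rewrite !(tally_split _ c pq).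
rewrite (eq_bigr (fun r => ((g r).2 == c) : nat)); last first.
  by move=> r /andP[rp rq]; rewrite fg.
by move: (\sum_(_ | _) _) => u; lia.
Qed.

Lemma tally_perm f (s : 'S_m) c : tally [ffun p => f (s p)] c = tally f c.
Proof.
rewrite /tally [RHS](reindex_inj (@perm_inj _ s)).
by apply: eq_bigr => p _; rewrite ffunE.
Qed.

Definition at_most_one_dot f : Prop :=
  forall p q, (f p).2 = Dot -> (f q).2 = Dot -> p = q.

Lemma tally_at_most_one_dot f : tally f Dot <= 1 -> at_most_one_dot f.
Proof.
move=> h p q fp fq; apply/eqP; apply: contraLR h => pq.
by rewrite (tally_split f Dot pq) fp fq eqxx.
Qed.

(** Counts replace the permutation in [Config]. The count of [Zero] is left out: [config_zeros]
    recovers it from the total [m]. *)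
Record is_config (k : state n) (a b : nat) f : Prop := IsConfig {
  config_state : forall p, (f p).1 = k;
  config_tally : forall c, c != Zero -> tally f c = register_content a b c
}.

Lemma config_zeros k a b f : is_config k a b f -> tally f Zero + (a + b).+1 = m.
Proof.
case=> _ h; have := tally_total f.
rewrite (bigD1 Dot) // (bigD1 Zero) // (bigD1 (Reg RegA)) // (bigD1 (Reg RegB)) //=.
rewrite big1; last by move=> [||| []]; rewrite //= h.
rewrite (h Dot) // (h (Reg RegA)) // (h (Reg RegB)) //=; lia.
Qed.

Lemma config_cross_free k a b f : is_config k a b f -> forall p, (f p).2 != Cross.
Proof.
case=> _ h p; apply/eqP => fp.
by have /tally_gt0P : exists p, (f p).2 = Cross; [exists p | rewrite h].
Qed.

Lemma config_dot k a b f : is_config k a b f -> exists p, (f p).2 = Dot.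
Proof. by case=> _ h; apply/tally_gt0P; rewrite h. Qed.

Lemma config_at_most_one_dot k a b f : is_config k a b f -> at_most_one_dot f.
Proof. by case=> _ h; apply: tally_at_most_one_dot; rewrite h. Qed.

Lemma config_word_is_config k a b : a + b < m -> is_config k a b (config_word m k a b).
Proof.
move=> hab; split=> [p|c c0]; first by rewrite ffunE.
(* Stated on natural numbers so that the sum splits at [1], [a.+1] and [(a + b).+1] into intervals
   on which the content is constant. *)
pose F (p : nat) := (if p == 0 then Dot else if p <= a then Reg RegA
  else if p <= a + b then Reg RegB else Zero) == c : nat.
transitivity (\sum_(0 <= p < m) F p).
  by rewrite big_mkord; apply: eq_bigr => p _; rewrite ffunE.
have const l u d : (forall p : nat, l <= p < u -> F p = (d == c)) ->
    \sum_(l <= p < u) F p = (u - l) * (d == c).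
  by move=> h; rewrite (eq_big_nat _ _ h) sum_nat_const_nat.
rewrite (@big_cat_nat _ _ _ 1) //=; last by lia.
rewrite (@big_cat_nat _ _ _ a.+1 1) //=; last by lia.
rewrite (@big_cat_nat _ _ _ (a + b).+1 a.+1) //=; last by lia.
rewrite (const 0 1 Dot); last by case.
rewrite (const 1 a.+1 (Reg RegA)); last first.
  by move=> p hp; rewrite /F; do ![case: ifP => //]; lia.
rewrite (const a.+1 (a + b).+1 (Reg RegB)); last first.
  by move=> p hp; rewrite /F; do ![case: ifP => //]; lia.
rewrite (const (a + b).+1 m Zero); last first.
  by move=> p hp; rewrite /F; do ![case: ifP => //]; lia.
by case: c c0 {F const} => [||| []] //=; lia.
Qed.

(** Equal counts of every content make the two lists of contents permutations of each other, and the
    state is constant. *)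
Lemma ConfigP k a b f : a + b < m -> Config k a b f <-> is_config k a b f.
Proof.
move=> hab; have [wst wt] := config_word_is_config k hab; split.
  case=> s ->; split=> [p|c c0]; first by rewrite ffunE wst.
  by rewrite tally_perm wt.
move=> cf; have [fst ft] := cf.
have tfw c : tally f c = tally (config_word m k a b) c.
  have [->|c0] := eqVneq c Zero; last by rewrite ft ?wt.
  have := config_zeros cf; have := config_zeros (config_word_is_config k hab).
  lia.
have count_tally g c : count_mem c [tuple (g p : elt n).2 | p < m] = tally g c.
  by rewrite /= count_map -sum1_count big_enum_cond /= big_mkcond.
have /tuple_permP[s /val_inj es] :
    perm_eq [tuple (f p).2 | p < m] [tuple (config_word m k a b p).2 | p < m].
  by apply/allP => c _ /=; rewrite !count_tally tfw.
exists s; apply/ffunP => p; rewrite ffunE.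
have := congr1 (fun t => tnth t p) es; rewrite !tnth_mktuple.
by move: (fst p) (wst (s p)); case: (f p) (config_word _ _ _ _ _) => [? ?] [? ?] /= -> -> ->.
Qed.

End Tally.

(** * Configurations reached within capacity are generated *)

Section Generation.
Variables (n : nat) (mach : machine n) (m : nat).
Implicit Types (f g x y : pow n m) (p q r : 'I_m).

Lemma sigma_is_config p : is_config initial 0 0 (sigma n p).
Proof.
split=> [r|c c0]; first by rewrite ffunE.
rewrite /tally (bigD1 p) //= ffunE eqxx big1 => [|r /negbTE rp].
  by case: c c0 => [||| []].
by rewrite ffunE rp /= eq_sym (negbTE c0).
Qed.

Lemma config_initial f : is_config initial 0 0 f -> exists p, f = sigma n p.
Proof.
move=> cf; have [p fp] := config_dot cf; exists p.
apply/ffunP => r; rewrite ffunE [LHS]surjective_pairing (config_state cf).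
congr pair; have [->//|rp] := eqVneq r p.
case E: (f r).2 => [||| R] //.
- by rewrite (config_at_most_one_dot cf E fp) eqxx in rp.
- by have := config_cross_free cf r; rewrite E.
have /tally_gt0P : exists r, (f r).2 = Reg R by exists r.
by rewrite (config_tally cf) //; case: R {E}.
Qed.

Lemma config_generated_fires k a b a' b' (i : instr n) f :
  instr_at mach k = Some i -> a + b < m ->
  (forall c, c != Zero ->
      register_content a' b' c + (erased i == c) =
      register_content a b c + (written i == c)) ->
  (forall g, is_config k a b g -> S_ mach g) ->
  is_config (target i) a' b' f -> S_ mach f.
Proof.
move=> hi hab upd gen cf.
have [q fq] := config_dot cf.
(* An increment writes a [Reg R], whose count in [f] is positive by the balance; a decrement writes
   a [Zero], and [(a' + b').+1 = a + b < m] leaves room for one. *)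
have [p fp] : exists p, (f p).2 = written i.
  apply/tally_gt0P; have zeros := config_zeros cf.
  case: i {hi} upd cf zeros => [[[? R] ?]|[[[? R] ?] ?]] /= upd cf zeros.
    by rewrite (config_tally cf) //; have := upd (Reg R) isT; rewrite eqxx /=; lia.
  by have := upd (Reg RegA) isT; have := upd (Reg RegB) isT; case: R {upd} => /=; lia.
have pq : p != q.
  by apply: contraFneq (written_Dot i) => pq; rewrite -fp pq fq.
have qp : q != p by rewrite eq_sym.
(* Undoes the step: [written i] at [p] and [Dot] at [q] are replaced by [Dot] and [erased i], in
   either order. [M] applied to the two orders gives [f]. *)
pose before (u v : content) : pow n m :=
  [ffun r => (k, if r == p then u else if r == q then v else (f r).2)].
have before_config u v : (u, v) \in [:: (Dot, erased i); (erased i, Dot)] ->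
    is_config k a b (before u v).
  move=> uv; split=> [r|c c0]; first by rewrite ffunE.
  have off r : r != p -> r != q -> (before u v r).2 = (f r).2.
    by move=> /negbTE rp /negbTE rq; rewrite ffunE /= rp rq.
  have := tally_exchange c pq off; have := upd c c0.
  rewrite (config_tally cf c0) fp fq !ffunE /= !eqxx (negbTE qp).
  by move: uv; rewrite !inE !xpair_eqE => /orP[] /andP[/eqP-> /eqP->]; lia.
have -> : f = [ffun r => op_M mach (before Dot (erased i) r) (before (erased i) Dot r)].
  apply/ffunP => r; rewrite !ffunE (op_M_instr _ _ hi) [LHS]surjective_pairing.
  rewrite (config_state cf); congr pair.
  have [->|rp] := eqVneq r p; first by rewrite !eqxx.
  have [->|rq] := eqVneq r q; first by rewrite fq erased_Dot !eqxx.
  have /negbTE fr : (f r).2 != Dot.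
    by apply: contra_neq rq => fr; apply: config_at_most_one_dot cf _ _ fr fq.
  by rewrite fr andbF eqxx.
by apply: gen_M; apply: gen; apply: before_config; rewrite !inE eqxx ?orbT.
Qed.

(** Relabelling [f] with the state [k] gives a preimage under [M'], which alters no content but
    [Reg R], and [f] contains none. *)
Lemma config_generated_zero k a b (i k' j : state n) R f :
  instr_at mach k = Some (inr (i, R, k', j)) ->
  register_content a b (Reg R) = 0 ->
  (forall g, is_config k a b g -> S_ mach g) ->
  is_config k' a b f -> S_ mach f.
Proof.
move=> hi R0 gen cf.
have -> : f = [ffun r => op_M' mach ([ffun r => (k, (f r).2)] r)].
  apply/ffunP => r; rewrite !ffunE /op_M' /St /Content /= hi.
  rewrite [LHS]surjective_pairing (config_state cf).
  case: eqP => // fr; suff /tally_gt0P : exists r, (f r).2 = Reg R.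
    by rewrite (config_tally cf) // R0.
  by exists r.
apply/gen_M'/gen; split=> [r|c c0]; first by rewrite ffunE.
by rewrite -(config_tally cf c0); apply: eq_bigr => r _; rewrite ffunE.
Qed.

Lemma config_generated t k a b f :
  run mach t = (k, a, b) -> step_capacity mach t (m - 1) -> 0 < m ->
  is_config k a b f -> S_ mach f.
Proof.
move=> + + m0; elim: t k a b f => [|t IH] k' a' b' f.
  case=> <- <- <- _ /config_initial[p ->]; apply: gen_base; by exists p.
rewrite /run iterS -/(run mach t); case E: (run mach t) => [[k a] b] st cap.
have {}IH g : is_config k a b g -> S_ mach g.
  by apply: IH => // s ? ? ? st'; apply: cap; apply: leq_trans st' _.
have hab : a + b < m by have := cap t _ _ _ (leqnSn t) E; lia.
have [k0|k0] := eqVneq k halting.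
  by move: st; rewrite /step k0 eqxx => -[<- <- <-]; rewrite -k0; apply: IH.
case hi: (instr_at mach k) => [i|]; last first.
  by move: st; rewrite /step (negbTE k0) hi => -[<- <- <-]; apply: IH.
(* The junk value at [Zero] puts increments in the positive case, so the other case is a zero
   test. *)
have [R0|pos] := posnP (register_content a b (erased i)).
  case: i hi R0 => [[[? ?] ?]|[[[i R] k1] j]] //= hi R0.
  move: st; rewrite (step_zero k0 hi R0) => -[<- <- <-].
  exact: config_generated_zero hi R0 IH.
have [a1 [b1 [st1 upd]]] := step_fires k0 hi pos.
by move: st; rewrite st1 => -[<- <- <-]; apply: config_generated_fires hi hab upd IH.
Qed.

(** * Generated cross-free tuples are reached configurations *)

Definition reached k a b : Prop :=
  exists t, run mach t = (k, a, b) /\ step_capacity mach t (m - 1).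

Lemma reached_initial : reached initial 0 0.
Proof. by exists 0; split=> // s ? ? ?; rewrite leqn0 => /eqP-> [_ <- <-]. Qed.

Lemma reached_step k a b k' a' b' :
  reached k a b -> step mach (k, a, b) = (k', a', b') -> a' + b' < m ->
  reached k' a' b'.
Proof.
case=> t [rt cap] st hab; have rt1 : run mach t.+1 = (k', a', b').
  by rewrite /run iterS -/(run mach t) rt.
exists t.+1; split=> // s i c d; rewrite leq_eqVlt => /predU1P[->|]; last exact: cap.
by rewrite rt1 => -[_ <- <-]; lia.
Qed.

(** [step] fixes every halting configuration, so the bound up to time [t] persists at all later
    times. *)
Lemma reached_halting a b : reached halting a b -> halts_with_capacity mach (m - 1).
Proof.
case=> t [rt cap]; split; last by exists t, a, b.
have stay d : run mach (d + t) = (halting, a, b).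
  by elim: d => // d IH; rewrite addSn /run iterS -/(run mach _) IH /step eqxx.
move=> s i c d; have [st|/ltnW ts] := leqP s t; first exact: cap.
by rewrite -(subnK ts) stay => -[_ <- <-]; apply: cap rt.
Qed.

(* The constant state makes [op_P] a selection between whole tuples, and the
   bound on dots makes [op_Ndot] one on cross-free values. *)
Record tame f : Prop := Tame {
  tame_state : exists k, forall p, (f p).1 = k;
  tame_dot : at_most_one_dot f;
  tame_config : (forall p, (f p).2 != Cross) ->
    exists k a b, reached k a b /\ is_config k a b f
}.

Hypothesis m_gt0 : 0 < m.
Hypothesis no_halt : ~ halts_with_capacity mach (m - 1).

(** [m_gt0] supplies a coordinate holding a cross, which makes the last clause of [tame] vacuous. *)
Lemma tame_all_cross k : tame [ffun=> (k, Cross)].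
Proof.
split=> [|p q|/(_ (Ordinal m_gt0))]; last by rewrite ffunE.
  by exists k => p; rewrite ffunE.
by rewrite ffunE.
Qed.

(** The hypothesis [no_halt] enters here: in the halting state, [x] would witness a halting run
    within capacity. *)
Lemma tame_cross_free_config x k : tame x -> (forall p, (x p).1 = k) ->
  (forall p, (x p).2 != Cross) ->
  exists a b, [/\ k != halting, reached k a b & is_config k a b x].
Proof.
case=> _ _ cfg xk /cfg[k1 [a [b [re cx]]]].
have kk : k1 = k by rewrite -(xk (Ordinal m_gt0)) (config_state cx).
subst k1; exists a, b; split=> //; apply/eqP => k0.
by rewrite k0 in re; apply: no_halt; apply: reached_halting re.
Qed.

Lemma tame_cross_free_dot x : tame x -> (forall p, (x p).2 != Cross) ->
  exists p, (x p).2 = Dot.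
Proof. by case=> _ _ cfg /cfg[k [a [b [_ /config_dot]]]]. Qed.

Lemma tame_not_halting x : tame x ->
  ~ (forall p, (x p == (halting, Zero)) || (x p == (halting, Dot))).
Proof.
move=> tx h; have [||? [? [+ _ _]]] := tame_cross_free_config (k := halting) tx.
- by move=> p; case/orP: (h p) => /eqP->.
- by move=> p; case/orP: (h p) => /eqP->.
by rewrite eqxx.
Qed.

Lemma tame_meet x y : tame x -> tame y -> tame [ffun p => op_meet (x p) (y p)].
Proof.
move=> tx [[ky yk] _ _]; have [[kx xk] dx cx] := tx; split.
- exists (if kx <= ky then kx else ky) => p; rewrite ffunE /op_meet /St xk yk.
  by case: eqP => // xy; rewrite -(yk p) -xy xk leqnn.
- move=> p q; rewrite !ffunE /op_meet.
  by case: ifP => // _; case: ifP => // _; apply: dx.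
move=> h; have E : [ffun p => op_meet (x p) (y p)] = x.
  by apply/ffunP => p; have := h p; rewrite ffunE /op_meet; case: ifP.
by move: h; rewrite E.
Qed.

Lemma tame_M x y : tame x -> tame y -> tame [ffun p => op_M mach (x p) (y p)].
Proof.
move=> tx ty; have [[k xk] dx _] := tx; have [[ky yk] dy _] := ty.
have [kk|kk] := eqVneq ky k; last first.
  suff -> : [ffun p => op_M mach (x p) (y p)] = [ffun=> (ky, Cross)].
    exact: tame_all_cross.
  by apply/ffunP => p; rewrite !ffunE /op_M /toX /St xk yk eq_sym (negbTE kk).
subst ky; case hi: (instr_at mach k) => [i|]; last first.
  suff -> : [ffun p => op_M mach (x p) (y p)] = [ffun=> (k, Cross)].
    exact: tame_all_cross.
  by apply/ffunP => p; rewrite !ffunE /op_M /toX /St xk yk eqxx hi.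
set f := finfun _.
have fE p : f p = (target i,
    if ((x p).2 == Dot) && ((y p).2 == erased i) then written i
    else if ((x p).2 == erased i) && ((y p).2 == Dot) then Dot
    else if ((x p).2 == (y p).2) && ((x p).2 != Dot) then (x p).2 else Cross).
  rewrite ffunE -(op_M_instr _ _ hi); congr op_M.
    by rewrite [LHS]surjective_pairing xk.
  by rewrite [LHS]surjective_pairing yk.
split=> [|p q|h]; first by exists (target i) => p; rewrite fE.
  (* A [Dot] in the value sits where [y] has one: [written i] is not [Dot], and two equal dots give
     a cross. *)
  suff fy r : (f r).2 = Dot -> (y r).2 = Dot by move=> /fy yp /fy; apply: dy.
  rewrite fE /=; case: ifP => [_ /eqP|_]; first by rewrite written_Dot.
  by case: ifP => [/andP[_ /eqP]|_] //; case: ifP => // /andP[_ /eqP].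
(* A cross is never [erased i], so a cross in either argument gives a cross. *)
have xc p : (x p).2 != Cross.
  have := h p; rewrite fE /=; apply: contra_neq => ->.
  by rewrite [Cross == erased i]eq_sym erased_Cross; case: ifP.
have yc p : (y p).2 != Cross.
  have := h p; rewrite fE /=; apply: contra_neq => ->.
  by rewrite [Cross == erased i]eq_sym erased_Cross !andbF; case: ifP => // /andP[/eqP].
have [a [b [k0 re cx]]] := tame_cross_free_config tx xk xc.
have [p xp] := tame_cross_free_dot tx xc.
have [q yq] := tame_cross_free_dot ty yc.
(* [M] sends two dots to a cross, so the dots of [x] and [y] lie apart; cross-freeness then forces
   [erased i] opposite each dot and equal contents elsewhere. *)
have pq : p != q.
  apply/eqP => pq; subst q; have := h p.
  by rewrite fE xp yq ![Dot == erased i]eq_sym erased_Dot.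
have yp : (y p).2 == erased i.
  have := h p; rewrite fE xp eqxx /= andbF [Dot == erased i]eq_sym erased_Dot /=.
  by case: ifP.
have xq : (x q).2 == erased i.
  have := h q; rewrite fE yq eqxx andbT [Dot == erased i]eq_sym erased_Dot andbF /=.
  by rewrite andbN; case: ifP.
have off r : r != p -> r != q -> (f r).2 = (x r).2.
  move=> rp rq; have := h r; rewrite fE /=.
  have /negbTE-> : (x r).2 != Dot by apply: contra_neq rp => /dx; apply.
  have /negbTE-> : (y r).2 != Dot by apply: contra_neq rq => /dy; apply.
  by rewrite andbF andbT /=; case: ifP.
have fp : (f p).2 = written i by rewrite fE xp yp eqxx.
have fq : (f q).2 = Dot by rewrite fE (eqP xq) yq erased_Dot !eqxx.
have pos : 0 < register_content a b (erased i).
  have [->//|e0] := eqVneq (erased i) Zero.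
  by rewrite -(config_tally cx e0); apply/tally_gt0P; exists q; apply/eqP.
have [a' [b' [st upd]]] := step_fires k0 hi pos.
have cf : is_config (target i) a' b' f.
  split=> [r|c c0]; first by rewrite fE.
  have := tally_exchange c pq off; have := upd c c0.
  by rewrite (config_tally cx c0) fp fq xp (eqP xq); lia.
exists (target i), a', b'; split=> //; apply: reached_step re st _.
by have := config_zeros cf; lia.
Qed.

Lemma tame_M' x : tame x -> tame [ffun p => op_M' mach (x p)].
Proof.
move=> tx; have [[k xk] dx _] := tx.
have all_cross : (forall p, op_M' mach (x p) = (k, Cross)) ->
    tame [ffun p => op_M' mach (x p)].
  move=> h; suff -> : [ffun p => op_M' mach (x p)] = [ffun=> (k, Cross)].
    exact: tame_all_cross.
  by apply/ffunP => p; rewrite !ffunE h.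
case hi: (instr_at mach k) => [[i|[[[i R] k'] j]]|].
- by apply: all_cross => p; rewrite /op_M' /St xk hi /toX /St xk.
- set f := finfun _.
  have fE p : f p = (k', if (x p).2 != Reg R then (x p).2 else Cross).
    by rewrite ffunE /op_M' /St xk hi /Content; case: ifP.
  split=> [|p q|h]; first by exists k' => p; rewrite fE.
    by rewrite !fE /=; case: ifP => // _; case: ifP => // _; apply: dx.
  (* Cross-freeness excludes [Reg R] from [x], so that register is zero and the machine takes the
     zero-test branch. *)
  have xR p : (x p).2 != Reg R by have := h p; rewrite fE; case: ifP.
  have fx p : (f p).2 = (x p).2 by rewrite fE xR.
  have xc p : (x p).2 != Cross by rewrite -fx.
  have [a [b [k0 re cx]]] := tame_cross_free_config tx xk xc.
  have R0 : register_content a b (Reg R) = 0.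
    by rewrite -(config_tally cx) // tally_eq0.
  exists k', a, b; split.
    by apply: reached_step re (step_zero k0 hi R0) _; have := config_zeros cx; lia.
  split=> [p|c c0]; first by rewrite fE.
  by rewrite -(config_tally cx c0); apply: eq_bigr => p _; rewrite fx.
by apply: all_cross => p; rewrite /op_M' /St xk hi /toX /St xk.
Qed.

Lemma tame_sigma p : tame (sigma n p).
Proof.
have cf := sigma_is_config p; split; first by exists initial; apply: config_state cf.
  exact: config_at_most_one_dot cf.
by exists initial, 0, 0; split=> //; apply: reached_initial.
Qed.

Lemma tame_I x y : tame x -> tame y -> tame [ffun p => op_I (x p) (y p)].
Proof.
move=> [_ dx _] ty; split.
- by exists initial => p; rewrite ffunE /op_I; case: ifP => // _; case: ifP.
- have idot r : (op_I (x r) (y r)).2 = Dot -> (x r).2 = Dot.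
    by rewrite /op_I; case: ifP => [/eqP|_] //; case: ifP.
  by move=> p q; rewrite !ffunE => /idot xp /idot; apply: dx.
(* A dot of [x] at [p] is its only one, so the value is [sigma n p]; with no dot in [x], [y] would
   be cross-free and dotless, against [tame_cross_free_dot]. *)
move=> h; have [/existsP[p xp]|] := boolP [exists p, inD (x p)].
  suff -> : [ffun p => op_I (x p) (y p)] = sigma n p.
    exact: tame_config (tame_sigma p) (config_cross_free (sigma_is_config p)).
  apply/ffunP => r; have := h r; rewrite !ffunE /op_I.
  have [->|rp] := eqVneq r p; first by rewrite xp.
  have /negbTE-> : ~~ inD (x r).
    by apply: contra rp => xr; apply/eqP/dx; apply/eqP.
  by case: ifP.
rewrite negb_exists => /forallP noD.
have yC p : inC (y p).
  by have := h p; rewrite ffunE /op_I (negbTE (noD p)); case: ifP.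
have [p|p yp] := tame_cross_free_dot ty; first by case/andP: (yC p).
by case/andP: (yC p) => _; rewrite /inD /Content yp.
Qed.

Lemma tame_H x : tame x -> tame [ffun p => op_H (x p)].
Proof.
move=> tx; split.
- by exists halting => p; rewrite ffunE /op_H; case: ifP.
- by move=> p q; rewrite ffunE /op_H; case: ifP.
move=> h; case: (tame_not_halting tx) => p.
by have := h p; rewrite ffunE /op_H; case: ifP.
Qed.

Lemma tame_N0 x y z : tame x -> tame y -> tame z ->
  tame [ffun p => op_N0 (x p) (y p) (z p)].
Proof.
move=> tx [[k yk] dy _] [[kz zk] _ _].
have [kk|kk] := eqVneq k kz; last first.
  suff -> : [ffun p => op_N0 (x p) (y p) (z p)] =
      [ffun=> (if k <= kz then k else kz, Cross)] by exact: tame_all_cross.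
  apply/ffunP => p; rewrite !ffunE /op_N0 /toX /op_meet /St yk zk (negbTE kk) !andbF.
  by case: eqP => // yz; rewrite -(yk p) -(zk p) yz eqxx in kk.
subst kz; split.
- exists k => p; rewrite ffunE /op_N0; case: ifP => // _; case: ifP => // _.
  by rewrite /toX /op_meet /St /= yk zk leqnn; case: ifP.
(* The branch returning [z] excludes dots, so every dot comes from [y]. *)
- have ndot r : (op_N0 (x r) (y r) (z r)).2 = Dot -> (y r).2 = Dot.
    rewrite /op_N0; case: ifP => // _; case: ifP => // /and3P[_ /eqP zD _] zr.
    by case: zD.
  by move=> p q; rewrite !ffunE => /ndot yp /ndot; apply: dy.
move=> h; case: (tame_not_halting tx) => p; have := h p; rewrite ffunE /op_N0.
by case: ifP => [/andP[-> _]|_]; rewrite ?orbT //; case: ifP => // /and3P[->].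
Qed.

Lemma tame_S x y z : tame x -> tame [ffun p => op_S (x p) (y p) (z p)].
Proof.
move=> tx; split.
- by exists initial => p; rewrite ffunE /op_S; case: ifP.
- by move=> p q; rewrite ffunE /op_S; case: ifP.
move=> h; have x0 p : x p = (initial, Zero).
  by have := h p; rewrite ffunE /op_S; case: ifP => // /andP[/eqP].
by have [p|p] := tame_cross_free_dot tx; rewrite x0.
Qed.

(** A choice between [x] and [y] is open only where [u] has a dot; a returned [z] is one of the
    two. *)
Lemma op_Ndot_cross_free (u x y z w : elt n) : w = op_Ndot u x y z ->
  w.2 != Cross -> (w = x /\ w = y) \/ (inD u /\ (w = x \/ w = y)).
Proof.
rewrite /op_Ndot => ->.
case: ifP => [/and3P[_ /eqP-> _]|_]; first by left.
case: ifP => [/and3P[_ -> _]|_]; first by right; split; [|left].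
case: ifP => [/and3P[_ -> _]|_]; first by right; split; [|right].
case: ifP => // /and3P[_ -> /orP[]/eqP->] _; right; split=> //; first by left.
by right.
Qed.

Lemma tame_Ndot u x y z : tame u -> tame x -> tame y -> tame z ->
  tame [ffun p => op_Ndot (u p) (x p) (y p) (z p)].
Proof.
move=> [_ du _] tx ty [[kz zk] _ _].
have [[kx xk] dx cx] := tx; have [[ky yk] dy cy] := ty.
set f := finfun _.
have fE p : f p = op_Ndot (u p) (x p) (y p) (z p) by rewrite ffunE.
have cases p := op_Ndot_cross_free (fE p).
split.
- have op_meet_St (v w : elt n) : St (op_meet v w) = if St v <= St w then St v else St w.
    by rewrite /op_meet; case: eqP => [->|//]; rewrite leqnn.
  pose k1 := if kx <= ky then kx else ky.
  exists (if k1 <= kz then k1 else kz) => p; rewrite fE /op_Ndot.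
  have [|] := boolP ((St (x p) == St (y p)) && (St (y p) == St (z p))); last first.
    by move=> _ /=; rewrite !op_meet_St /St xk yk zk.
  rewrite /toX !op_meet_St /k1 /St xk yk zk => /andP[/eqP kk /eqP kk'].
  by subst kx ky; rewrite leqnn leqnn; do ![case: ifP => _].
(* A dot of [f] is either common to [x] and [y], or lies at a dot of [u] and in one of them; any two
   such dots share one of [u], [x], [y]. *)
- have fdot p : (f p).2 = Dot -> ((x p).2 = Dot /\ (y p).2 = Dot) \/
      ((u p).2 = Dot /\ ((x p).2 = Dot \/ (y p).2 = Dot)).
    move=> fp; have := cases p; rewrite fp => /(_ isT) -[[<- <-]|[/eqP up e]].
      by left.
    by right; split=> //; case: e => <-; [left|right].
  move=> p q /fdot[[xp yp]|[up xyp]] /fdot[[xq yq]|[uq xyq]].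
  + exact: dx.
  + by case: xyq => [/(dx _ _ xp)|/(dy _ _ yp)].
  + by case: xyp => [/dx/(_ xq)|/dy/(_ yq)].
  exact: du.
(* Off the single dot of [u], [f] agrees with both [x] and [y], so the value at that dot decides
   which of them [f] is. *)
move=> h; suff [E|E] : f = x \/ f = y by move: h; rewrite E.
have {}cases p := cases p (h p).
have [/existsP[p up]|] := boolP [exists p, inD (u p)]; last first.
  rewrite negb_exists => /forallP noD; left; apply/ffunP => r.
  by case: (cases r) => [[]|[ur]] //; have := noD r; rewrite ur.
have off r : r != p -> f r = x r /\ f r = y r.
  move=> rp; case: (cases r) => // -[ur _]; case/eqP: rp; apply: du; exact/eqP.
have [fp|fp] : f p = x p \/ f p = y p by case: (cases p) => [[]|[]]; [left|].
  by left; apply/ffunP => r; have [->|/off[]] := eqVneq r p.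
by right; apply/ffunP => r; have [->|/off[]] := eqVneq r p.
Qed.

Lemma tame_P u v x y : tame u -> tame v -> tame x -> tame y ->
  tame [ffun p => op_P (u p) (v p) (x p) (y p)].
Proof.
move=> [[ku uk] _ _] [[kv vk] _ _] tx ty.
suff -> : [ffun p => op_P (u p) (v p) (x p) (y p)] = if ku == kv then x else y.
  by case: ifP.
by apply/ffunP => p; rewrite ffunE /op_P /St uk vk; case: ifP.
Qed.

Lemma generated_tame f : S_ mach f -> tame f.
Proof.
elim=> {f} [f [p ->]|*|*|*|*|*|*|*|*|*].
- exact: tame_sigma.
- exact: tame_meet.
- exact: tame_M.
- exact: tame_M'.
- exact: tame_I.
- exact: tame_H.
- exact: tame_N0.
- exact: tame_S.
- exact: tame_Ndot.
- exact: tame_P.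
Qed.

(** The counts of one tuple determine [a] and [b], so the configuration supplied by tameness is the
    given one. *)
Lemma generated_config_reached k a b f :
  S_ mach f -> is_config k a b f -> reached k a b.
Proof.
move=> /generated_tame tf cf.
have [a' [b' [_ re cf']]] :=
  tame_cross_free_config tf (config_state cf) (config_cross_free cf).
have eqR R : register_content a' b' (Reg R) = register_content a b (Reg R).
  by rewrite -(config_tally cf) // -(config_tally cf').
by move: (eqR RegA) (eqR RegB) re => /= -> ->.
Qed.

End Generation.

Theorem theorem5p12 (n : nat) (mach : machine n) (m : nat)
    (hmach : standing mach) (hm : 1 <= m) :
  (forall (t : nat) (k : state n) (a b : nat),
      run mach t = (k, a, b) -> step_capacity mach t (m - 1) ->
      forall f : pow n m, Config k a b f -> S_ mach f)
  /\
  (forall (k : state n) (a b : nat),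
      a + b < m ->
      (forall f : pow n m, Config k a b f -> S_ mach f) ->
      ~ halts_with_capacity mach (m - 1) ->
      exists t : nat,
        run mach t = (k, a, b) /\ step_capacity mach t (m - 1)).
Proof.
split=> [t k a b rt cap f|k a b hab gen no_halt].
  have hab : a + b < m by have := cap t _ _ _ (leqnn t) rt; lia.
  by move=> /(ConfigP _ _ hab); apply: config_generated rt cap hm.
have cw := config_word_is_config k hab.
(* A single generated member of [Config] suffices, here the unpermuted one. *)
have Sw : S_ mach (config_word m k a b) by apply/gen/(ConfigP _ _ hab).
exact (generated_config_reached hm no_halt Sw cw).
Qed.
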